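(* Let $d\ge0$ and $l\ge1$ be integers, $\alpha_1,\dots,\alpha_d\in\mathbb{C}$, $\rho\in\mathbb{C}\setminus\{0\}$, $\eta=l^{d+1}\rho$, $\eta_1=\frac{(-1)^{(d+1)l}\eta}{l}$, $i\in\{0,\dots,l-1\}$, and assume that none of the entries of the list $\hat S(i)$ is a non-positive integer. For $m\ge0$ let $$Q_{ml+i}(x)=(-1)^i(-x)_i\;{}_{1+l}F_{ld+l-1}\left[\begin{matrix}-m,\Delta(l;-x+i)\\ \hat S(i)\end{matrix};\eta_1^{\,l}\right].$$ Then the function $$\Phi_i(x,t)=(-1)^i(-x)_i\,t^i\,e^{t^l}\;{}_lF_{ld+l-1}\left[\begin{matrix}\Delta(l;-x+i)\\ \hat S(i)\end{matrix};-(\eta_1t)^l\right]$$ is a generating function for the polynomials $Q_{ml+i}(x)$ in the sense that (as formal power series in $t$) $$\sum_{m=0}^{\infty}\frac{t^{ml+i}}{m!}\,Q_{ml+i}(x)=\Phi_i(x,t).$$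
   Context: The symbol $\Delta(l;\lambda)$ denotes the list of $l$ parameters $\frac{\lambda}{l},\frac{\lambda+1}{l},\dots,\frac{\lambda+l-1}{l}$. Put $\alpha_{d+1}=0$ and, for $i\in\{0,\dots,l-1\}$, $1\le k\le d+1$, $0\le r\le l-1$, put $S_{k,r}(i)=\frac{\alpha_k+i-r}{l}+1$. Note $S_{d+1,i}(i)=1$. Let $\hat S(i)$ be the list (with multiplicity) of the $ld+l-1$ numbers $S_{k,r}(i)$ over all pairs $(k,r)$ with $1\le k\le d+1$, $0\le r\le l-1$, except $(k,r)=(d+1,i)$. Pochhammer symbol: $(a)_0=1$, $(a)_j=a(a+1)\cdots(a+j-1)$. Generalized hypergeometric series: ${}_pF_q\left[\begin{matrix}a_1,\dots,a_p\\ b_1,\dots,b_q\end{matrix};z\right]=\sum_{j\ge0}\frac{(a_1)_j\cdots(a_p)_j}{(b_1)_j\cdots(b_q)_j}\frac{z^j}{j!}$, understood as a formal power series in $z$ when it does not converge. *)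

(* Defs.v *)
From mathcomp Require Export all_boot all_order all_algebra.
From mathcomp Require Export complex.
From mathcomp Require Export boolp classical_sets reals topology normedtype sequences.

Set Implicit Arguments.
Unset Strict Implicit.
Unset Printing Implicit Defensive.

Import Order.TTheory GRing.Theory Num.Theory.
Import numFieldNormedType.Exports.

Local Open Scope ring_scope.
Local Open Scope classical_set_scope.

Definition poch (K : numFieldType) (a : K) (j : nat) : K :=
  \prod_(k < j) (a + k%:R).

(* Delta(l; lam) = lam/l, (lam+1)/l, ..., (lam+l-1)/l *)
Definition Delta (K : numFieldType) (l : nat) (lam : K) : seq K :=
  [seq (lam + j%:R) / l%:R | j <- iota 0 l].

(* A formal power series in t is its sequence of coefficients: f n = [t^n] f.
   The pointwise operations that nat -> K could inherit are not used. *)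
Definition fps (K : numFieldType) : Type := nat -> K.

Definition fps_one (K : numFieldType) : fps K := fun n => (n == 0)%N%:R.

Definition fps_X {K : numFieldType} : fps K := fun n => (n == 1)%N%:R.

Definition fps_scale (K : numFieldType) (c : K) (f : fps K) : fps K :=
  fun n => c * f n.

Definition fps_mul (K : numFieldType) (f g : fps K) : fps K :=
  fun n => \sum_(k < n.+1) f k * g (n - k)%N.

Definition fps_pow (K : numFieldType) (f : fps K) (j : nat) : fps K :=
  iter j (fps_mul f) (fps_one K).

(* Substitution f(g(t)), meaningful when g 0 = 0: then g^j has no coefficient
   below t^j, so that the terms j <= n are the only ones contributing to t^n. *)
Definition fps_comp (K : numFieldType) (f g : fps K) : fps K :=
  fun n => \sum_(j < n.+1) f j * fps_pow g j n.

Definition fps_exp (K : numFieldType) : fps K := fun n => (n`!%:R)^-1.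

(* \sum_(m >= 0) u m = f for the t-adic topology: each coefficient of the
   partial sums is eventually equal to that of f. *)
Definition fps_is_sum (K : numFieldType) (u : nat -> fps K) (f : fps K) : Prop :=
  forall n, exists N, forall M, (N <= M)%N -> \sum_(m < M) u m n = f n.

(* The series pFq[as; bs; z] as a formal power series in z. *)
Definition hyper_fps (K : numFieldType) (as_ bs : seq K) : fps K :=
  fun j => (\prod_(a <- as_) poch a j) / (\prod_(b <- bs) poch b j) / (j`!)%:R.

(* The value of pFq[as; bs; z] at the number z, as the limit in K of the
   partial sums; meaningful when the series converges, in particular when it
   terminates. *)
Definition hyper_val (K : numFieldType) (as_ bs : seq K) (z : K) : K :=
  lim (series (fun j => hyper_fps as_ bs j * z ^+ j) @ \oo).

(* alpha_1, ..., alpha_d, followed by alpha_(d+1) = 0; indices start at 0, so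
   that k : 'I_d.+1 stands for k+1 and ord_max for d+1. *)
Definition alpha_ext (K : numFieldType) (d : nat) (alpha : 'I_d -> K)
  (k : 'I_d.+1) : K := oapp alpha 0 (unlift ord_max k).

Definition S_ (K : numFieldType) (d l : nat) (alpha : 'I_d -> K) (i : 'I_l)
  (k : 'I_d.+1) (r : 'I_l) : K :=
  (alpha_ext alpha k + i%:R - r%:R) / l%:R + 1.

Definition Shat (K : numFieldType) (d l : nat) (alpha : 'I_d -> K) (i : 'I_l) :
  seq K :=
  [seq S_ alpha i kr.1 kr.2 |
     kr <- enum {: 'I_d.+1 * 'I_l} & kr != (ord_max, i)].

Definition eta (K : numFieldType) (d l : nat) (rho : K) : K :=
  l%:R ^+ d.+1 * rho.

Definition eta1 (K : numFieldType) (d l : nat) (rho : K) : K :=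
  (-1) ^+ (d.+1 * l) * eta d l rho / l%:R.

(* Q_(ml+i)(x) *)
Definition Q (K : numFieldType) (d l : nat) (alpha : 'I_d -> K) (rho : K)
  (i : 'I_l) (m : nat) (x : K) : K :=
  (-1) ^+ i * poch (- x) i *
  hyper_val (- m%:R :: Delta l (- x + i%:R)) (Shat alpha i)
    (eta1 d l rho ^+ l).

(* Phi_i(x, t), as a formal power series in t *)
Definition Phi (K : numFieldType) (d l : nat) (alpha : 'I_d -> K) (rho : K)
  (i : 'I_l) (x : K) : fps K :=
  let t : fps K := fps_X in
  let exp_tl := fps_comp (fps_exp K) (fps_pow t l) in
  let F :=
    fps_comp (hyper_fps (Delta l (- x + i%:R)) (Shat alpha i))
      (fps_scale (-1) (fps_pow (fps_scale (eta1 d l rho) t) l)) in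
  fps_scale ((-1) ^+ i * poch (- x) i)
    (fps_mul (fps_mul (fps_pow t i) exp_tl) F).

(* Main.v *)
Require Import Defs.
From mathcomp Require Import all_boot all_order all_algebra complex reals.
From mathcomp Require Import ring.

Import Order.TTheory GRing.Theory Num.Theory.
Import numFieldNormedType.Exports.
Local Open Scope ring_scope.
Local Open Scope complex_scope.

(** The generating function is a Cauchy product.  With [w] standing for [t^l],
    the series [Phi] is [t^i] times the product of [exp w] and of
    [F(- eta1^l w) = sum_j (-1)^j F_j eta1^(l j) w^j], up to a constant.
    The coefficient of [w^m] in this product is the sum over [j <= m] of
    [(-1)^j F_j eta1^(l j) / (m - j)!].
    Since [(-m)_j = (-1)^j m! / (m - j)!] vanishes for [j > m], that sum is
    [1/m!] times the terminating series which defines [Q_(ml+i)]: the parameter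
    [-m] of the polynomial is exactly what the factor [exp(t^l)] produces.

    Three facts carry this out: substitution of [c t^l] is multiplicative
    ([fps_mul_comp_monomial]), so that the product can be taken in [w]; the
    convergent value of a hypergeometric series with a parameter [-m] is its
    sum up to [m] ([hyper_val_terminating]); and the evaluation of [(-m)_j]
    above ([poch_oppn]), which turns that sum into the Cauchy product
    ([hyper_val_div_fact]).  A coefficientwise comparison then ends the proof:
    each power of [t] receives at most one term of the sum over [m]. *)

Section PowerSeries.
Context {K : numFieldType}.
Implicit Types (f g : fps K) (c : K).

(** All the series substituted in [Phi] are of this form, and its
    powers and products have closed formulas. *)
Definition monomial c (a : nat) : fps K := fun n : nat => c * (n == a)%:R.

Lemma sum_ord_pick (F : nat -> K) N a :
  \sum_(k < N) (nat_of_ord k == a)%:R * F k = (a < N)%N%:R * F a.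
Proof.
rewrite -(big_mkord xpredT (fun k => (k == a)%:R * F k)).
have [aN|Na] := ltnP a N; last first.
  rewrite mul0r big_nat big1 // => k /andP[_ kN].
  by rewrite ltn_eqF ?mul0r // (leq_trans kN).
rewrite big_mkord (bigD1 (Ordinal aN)) //= eqxx !mul1r big1 ?addr0 // => k ka.
by rewrite (negPf (_ : nat_of_ord k != a)) ?mul0r.
Qed.

Lemma sum_ord_pick_divn (F : nat -> K) N l n : (0 < l)%N -> (n < N)%N ->
  \sum_(j < N) (n == l * j)%N%:R * F j = (l %| n)%:R * F (n %/ l)%N.
Proof.
move=> l0 nN; have [/dvdnP[q nE]|ldn] := boolP (l %| n)%N; last first.
  rewrite mul0r big1 // => j _.
  case: eqP => [nE|_]; last by rewrite mul0r.
  by rewrite nE dvdn_mulr in ldn.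
rewrite nE in nN *.
under eq_bigr do rewrite (mulnC l) eqn_pmul2r // eq_sym.
rewrite sum_ord_pick mulnK // (leq_ltn_trans _ nN) //.
by rewrite leq_pmulr.
Qed.

Lemma fps_mul_monomial c a f n :
  fps_mul (monomial c a) f n = (a <= n)%N%:R * (c * f (n - a)%N).
Proof.
rewrite /fps_mul -ltnS -(sum_ord_pick (fun k => c * f (n - k)%N)).
by apply: eq_bigr => k _; rewrite /monomial mulrCA mulrA.
Qed.

Lemma fps_mul_monomial_monomial c c' a b :
  fps_mul (monomial c a) (monomial c' b) = monomial (c * c') (a + b).
Proof.
apply/funext => n; rewrite fps_mul_monomial /monomial.
have [an|na] := leqP a n; last first.
  by rewrite mul0r (ltn_eqF (ltn_addr _ na)) mulr0.
by rewrite mul1r mulrA -[in LHS](eqn_add2l a) subnKC.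
Qed.

Lemma fps_pow_monomial c a j :
  fps_pow (monomial c a) j = monomial (c ^+ j) (a * j).
Proof.
elim: j => [|j IH].
  by apply/funext => n; rewrite /monomial muln0 mul1r.
rewrite /fps_pow iterS -/(fps_pow _ _) IH fps_mul_monomial_monomial.
by rewrite -exprS -mulnS.
Qed.

Lemma fps_X_monomial : fps_X = monomial 1 1.
Proof. by apply/funext => n; rewrite /monomial mul1r. Qed.

Lemma fps_scale_monomial c c' a :
  fps_scale c (monomial c' a) = monomial (c * c') a.
Proof. by apply/funext => n; rewrite /fps_scale /monomial mulrA. Qed.

(** The special case of associativity in which the common factor is a power
    of [t]. *)
Lemma fps_mul_monomialA c a f g :
  fps_mul (fps_mul (monomial c a) f) g = fps_mul (monomial c a) (fps_mul f g).
Proof.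
apply/funext => n; rewrite fps_mul_monomial {1}/fps_mul.
under eq_bigr do rewrite fps_mul_monomial.
have [an|na] := leqP a n; last first.
  rewrite mul0r big1 // => k _.
  by rewrite leqNgt (leq_ltn_trans _ na) ?mul0r // -ltnS.
rewrite mul1r; move: (n - a)%N (subnKC an) => p <-.
rewrite -addnS big_split_ord /= big1 ?add0r; last first.
  by move=> k _; rewrite leqNgt ltn_ord !mul0r.
rewrite /fps_mul mulr_sumr; apply: eq_bigr => k _.
by rewrite leq_addr mul1r addKn subnDl mulrA.
Qed.

Lemma fps_comp_monomial f c l n : (0 < l)%N ->
  fps_comp f (monomial c l) n = (l %| n)%:R * (f (n %/ l)%N * c ^+ (n %/ l)).
Proof.
move=> l0.
rewrite -(sum_ord_pick_divn (fun j => f j * c ^+ j) _ _ _ l0 (ltnSn n)) //.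
apply: eq_bigr => j _.
by rewrite fps_pow_monomial /monomial mulrA mulrC.
Qed.

(** Both sides are supported on the multiples of [l], and a sum of indices
    [l j + k = l q] forces [k] to be a multiple of [l] as well. *)
Lemma fps_mul_comp_monomial f g c c' l n : (0 < l)%N ->
  fps_mul (fps_comp f (monomial c l)) (fps_comp g (monomial c' l)) n =
  (l %| n)%:R *
    fps_mul (fun j => f j * c ^+ j) (fun j => g j * c' ^+ j) (n %/ l)%N.
Proof.
move=> l0.
pose h j := f j * c ^+ j; pose h' j := g j * c' ^+ j.
pose G k := fps_comp g (monomial c' l) (n - k)%N.
(* Taking every inner sum up to [n] makes its range independent of [k]. *)
have inner (k : 'I_n.+1) : fps_comp f (monomial c l) k =
    \sum_(j < n.+1) (nat_of_ord k == l * j)%N%:R * h j.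
  by rewrite fps_comp_monomial // (sum_ord_pick_divn _ _ _ _ l0 (ltn_ord k)).
rewrite {1}/fps_mul.
under eq_bigr do rewrite inner mulr_suml.
rewrite exchange_big /=.
transitivity (\sum_(j < n.+1 | (j < (n %/ l).+1)%N)
    (l %| n)%:R * (h j * h' (n %/ l - j)%N)); last first.
  rewrite -(big_ord_widen _ (fun j => (l %| n)%:R * (h j * h' (n %/ l - j)%N))).
    by rewrite -mulr_sumr.
  by rewrite ltnS leq_div.
rewrite [RHS]big_mkcond /=; apply: eq_bigr => j _.
under eq_bigr do rewrite -mulrA.
rewrite (sum_ord_pick (fun k => h j * G k)) !ltnS leq_divRL // (mulnC l).
case: leqP => [jn|_]; last by rewrite mul0r.
rewrite mul1r /G fps_comp_monomial // dvdn_subl ?dvdn_mull //.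
by rewrite divnBMl mulrCA.
Qed.

End PowerSeries.

Section Terminating.
Context {K : numFieldType}.

(** For [j > m] the product contains the factor [- m + m], and the falling
    factorial [m ^_ j] vanishes too. *)
Lemma poch_oppn m j : poch (- m%:R : K) j = (-1) ^+ j * (m ^_ j)%:R.
Proof.
rewrite /poch; elim: j => [|j IH]; first by rewrite big_ord0 mul1r.
rewrite big_ord_recr /= IH ffactnSr natrM exprS.
have [jm|mj] := leqP j m; first by rewrite natrB //; ring.
by rewrite ffact_small // !(mul0r, mulr0).
Qed.

Lemma hyper_fps_cons (a : K) as_ bs j :
  hyper_fps (a :: as_) bs j = poch a j * hyper_fps as_ bs j.
Proof. by rewrite /hyper_fps big_cons !mulrA. Qed.

Lemma hyper_val_terminating m (as_ bs : seq K) z :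
  hyper_val (- m%:R :: as_) bs z =
  \sum_(j < m.+1) hyper_fps (- m%:R :: as_) bs j * z ^+ j.
Proof.
apply: cvg_lim; first exact: norm_hausdorff.
apply: cvg_near_cst; exists m.+1 => //= N mN.
apply/eqP; rewrite /series /= (big_cat_nat (n := m.+1)) //= big_mkord.
rewrite [X in _ + X]big_nat [X in _ + X]big1 ?addr0 // => j /andP[mj _].
by rewrite hyper_fps_cons poch_oppn ffact_small // mulr0 !mul0r.
Qed.

(** As [(-m)_j / m! = (-1)^j / (m - j)!], the parameter [-m] amounts to a
    multiplication by the exponential series. *)
Lemma hyper_val_div_fact m (as_ bs : seq K) z :
  hyper_val (- m%:R :: as_) bs z / (m`!)%:R =
  fps_mul (fps_exp K) (fun j => hyper_fps as_ bs j * (- z) ^+ j) m.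
Proof.
rewrite hyper_val_terminating mulr_suml /fps_mul.
(* The terminating series is indexed by its own exponent, the Cauchy product
   by the exponent in the exponential factor. *)
rewrite (reindex_inj rev_ord_inj) /=; apply: eq_bigr => k _.
have km : (k <= m)%N by rewrite -ltnS.
rewrite subSS hyper_fps_cons poch_oppn /fps_exp.
have := ffact_fact (leq_subr k m); rewrite subKn // => mE.
have fact0 n : (n`!)%:R != 0 :> K by rewrite pnatr_eq0 -lt0n fact_gt0.
have -> : (k`!%:R)^-1 = (m ^_ (m - k))%:R / (m`!)%:R :> K.
  by apply: (mulIf (fact0 k)); rewrite mulVf // mulrAC -natrM mE divff.
by rewrite [in RHS]exprNn; ring.
Qed.

Lemma Phi_coef d l (alpha : 'I_d -> K) rho (i : 'I_l) x n :
  Phi alpha rho i x n =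
  ((i <= n)%N && (l %| n - i)%N)%:R *
    (Q alpha rho i ((n - i) %/ l) x / (((n - i) %/ l)`!)%:R).
Proof.
have l0 : (0 < l)%N by apply: leq_ltn_trans (ltn_ord i).
rewrite /Phi /= !fps_X_monomial fps_scale_monomial !fps_pow_monomial.
rewrite fps_scale_monomial !expr1n !mul1n !mulr1 mulN1r /fps_scale.
rewrite fps_mul_monomialA fps_mul_monomial mul1r fps_mul_comp_monomial //.
rewrite /Q -[X in _ = _ * X]mulrA hyper_val_div_fact -mulnb natrM.
have -> : (fun j => fps_exp K j * 1 ^+ j) = fps_exp K.
  by apply/funext => j; rewrite expr1n mulr1.
by ring.
Qed.

End Terminating.

Theorem theorem4p10 (R : realType) (d l : nat) (hl : (1 <= l)%N)
  (alpha : 'I_d -> R[i]) (rho : R[i]) (hrho : rho != 0) (i : 'I_l)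
  (hS : forall s : R[i], s \in Shat alpha i -> forall n : nat, s <> - n%:R)
  (x : R[i]) :
  fps_is_sum
    (fun m : nat =>
       fps_scale (Q alpha rho i m x / (m`!)%:R)
         (fps_pow fps_X (m * l + i)))
    (Phi alpha rho i x).
Proof.
move=> n; exists n.+1 => M nM; rewrite Phi_coef.
have coefE m : fps_scale (Q alpha rho i m x / (m`!)%:R)
    (fps_pow fps_X (m * l + i)) n =
    (n == m * l + i)%N%:R * (Q alpha rho i m x / (m`!)%:R).
  rewrite /fps_scale fps_X_monomial fps_pow_monomial /monomial expr1n mul1n.
  by rewrite mul1r mulrC.
under eq_bigr do rewrite coefE.
case: andP => [[le_in /dvdnP[q nE]]|no]; last first.
  rewrite mul0r big1 // => m _; case: eqP => [nE|_]; last by rewrite mul0r.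
  by case: no; rewrite nE leq_addl addnK dvdn_mull.
have -> : n = (q * l + i)%N by rewrite -nE subnK.
rewrite addnK mulnK //.
under eq_bigr do rewrite eqn_add2r eqn_pmul2r // eq_sym.
rewrite (sum_ord_pick (fun m => Q alpha rho i m x / (m`!)%:R)).
rewrite (leq_ltn_trans _ nM) // -(subnK le_in) nE.
by rewrite (leq_trans (leq_pmulr _ hl)) // leq_addr.
Qed.
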